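(* Consider a multi-urn search problem and a valid policy $\mathbf u$. For every stage $t$ and every urn $i\in\mathcal V$ for which the four probabilities below are defined and the two denominators are positive, $$\frac{\mathbb P\big(w(\mathbf x(t+1),u(t))=1\big)}{\mathbb P\big(w(\mathbf x(t),u(t))=1\big)}\ \ge\ \frac{\mathbb P\big(w(\mathbf x(t+1),i)=1\big)}{\mathbb P\big(w(\mathbf x(t),i)=1\big)}.$$
   Context: Multi-urn search problem. Let $\mathcal V$ be a finite nonempty set of urns. Urn $i\in\mathcal V$ contains $N_i\ge 1$ marbles ($N_i$ a known integer), at most one of which is red; all other marbles are blue. Let $A_i$ be the event that urn $i$ contains a red marble. For $U\subseteq\mathcal V$ put $\varphi_U=\mathbb P(\bigcap_{i\in U}A_i)$, with $\varphi_\emptyset=1$ and $\varphi_i=\varphi_{\{i\}}$; it is assumed that $\varphi_i>0$ for all $i$. The joint law of $(A_i)_{i\in\mathcal V}$ is arbitrary otherwise. Marbles are drawn from each urn in uniformly random order without replacement: given which urns contain a red marble, the position of the red marble in the draw order of each such urn $i$ is uniform on $\{1,\dots,N_i\}$, and these positions are independent across urns. Let $N=\sum_{i\in\mathcal V}N_i$. A valid policy is a sequence $\mathbf u=(u(0),\dots,u(N-1))$ of elements of $\mathcal V$ with $|\{t:u(t)=i\}|=N_i$ for every $i\in\mathcal V$; at stage $t=0,1,\dots$ a marble is drawn from urn $u(t)$ and discarded if blue, and the search stops when a red marble is drawn or all urns are empty. The state at stage $t$ is $\mathbf x(t)=(x_i(t))_{i\in\mathcal V}$ with $x_i(t)=|\{s<t:u(s)=i\}|$.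 Conditioning on $\mathbf x(t)$ means conditioning on the event that the first $t$ draws, from urns $u(0),\dots,u(t-1)$, all produced blue marbles; such conditional probabilities are considered only when this event has positive probability. For an urn $i$ with $x_i(t)<N_i$, $w(\mathbf x(t),i)\in\{0,1\}$ is the indicator that the next marble drawn from urn $i$ in state $\mathbf x(t)$ is red (whether or not $i=u(t)$), and its probability is taken conditionally on the first $t$ draws being blue; thus $\mathbb P(w(\mathbf x(t),i)=1)=\frac{1}{N_i-x_i(t)}\mathbb P(A_i\mid\mathbf x(t))$. ''Defined'' means that the urn in question is nonempty in the state in question and that this state is reached without a red marble with positive probability. *)

(* Defs.v *)
From HB Require Import structures.
From mathcomp Require Import all_boot all_order all_algebra.
From mathcomp Require Import all_classical all_reals all_analysis.

Set Implicit Arguments.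
Unset Strict Implicit.
Unset Printing Implicit Defensive.

Import Order.TTheory GRing.Theory Num.Theory.

Local Open Scope classical_set_scope.
Local Open Scope ring_scope.

Section MultiUrnSearch.
Context (R : realType) (V : finType) (d : measure_display)
  (T : measurableType d) (P : probability T R).

(* [red_pos i w] is [None] if urn [i] has no red marble in the outcome [w], and
   [Some k] if it has one (it never has two) and exactly [k] blue marbles of
   urn [i] come before it in the draw order; positions are thus counted from
   0.  The law of the set of urns with a red marble is arbitrary. *)
Definition urn_has_red (N : V -> nat)
    (red_pos : forall i : V, T -> option 'I_(N i)) (i : V) : set T :=
  [set w | red_pos i w <> None].

(* Exactly the urns in [S] have a red marble. *)
Definition red_urns_are (N : V -> nat)
    (red_pos : forall i : V, T -> option 'I_(N i)) (S : {set V}) : set T :=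
  [set w | forall i : V, i \in S <-> urn_has_red red_pos i w].

(* [red_pos_uniform]: given that [S] is the set of urns with a red marble, the
   positions in the urns of [S] are independent and uniform.  The conditional
   law is written in product form, so it says nothing when [S] has
   probability 0. *)
Record search_problem := SearchProblem {
  urns_nonempty : (0 < #|V|)%N;
  marbles : V -> nat;
  marbles_gt0 : forall i : V, (0 < marbles i)%N;
  red_pos : forall i : V, T -> option 'I_(marbles i);
  measurable_red_pos : forall (i : V) (o : option 'I_(marbles i)),
    measurable (red_pos i @^-1` [set o]);
  has_red_gt0 : forall i : V, (0 < P (urn_has_red red_pos i))%E;
  red_pos_uniform : forall (S : {set V}) (k : forall i : V, 'I_(marbles i)),
    P (red_urns_are red_pos S `&`
       [set w | forall i : V, i \in S -> red_pos i w = Some (k i)]) =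
    (P (red_urns_are red_pos S) *
     (\prod_(i in S) ((marbles i)%:R : R)^-1)%:E)%E
}.

Definition total_marbles (M : search_problem) : nat :=
  (\sum_(i : V) marbles M i)%N.

Definition valid_policy (M : search_problem)
    (u : (total_marbles M).-tuple V) : Prop :=
  forall i : V, count_mem i u = marbles M i.

Definition state n (u : n.-tuple V) (t : nat) (i : V) : nat :=
  count_mem i (take t u).

(* The event that the next marble of urn [i] is red when [x j] marbles have
   been removed from each urn [j]. *)
Definition next_red (M : search_problem) (x : V -> nat) (i : V) : set T :=
  [set w | exists2 k : 'I_(marbles M i), red_pos M i w = Some k & k = x i :> nat].

Definition all_blue (M : search_problem) (u : (total_marbles M).-tuple V)
    (t : nat) : set T :=
  [set w | forall s : 'I_(total_marbles M), (s < t)%N ->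
    ~ next_red M (state u s) (tnth u s) w].

Definition cond_prob (E F : set T) : R := fine (P (E `&` F)) / fine (P F).

(* The probability that the next marble of urn [i] in the state at stage [t]
   is red, given that the first [t] draws were blue. *)
Definition prob_red (M : search_problem) (u : (total_marbles M).-tuple V)
    (t : nat) (i : V) : R :=
  cond_prob (next_red M (state u t) i) (all_blue u t).

Definition prob_red_defined (M : search_problem)
    (u : (total_marbles M).-tuple V) (t : nat) (i : V) : Prop :=
  (state u t i < marbles M i)%N /\ (0 < P (all_blue u t))%E.

End MultiUrnSearch.

(* Main.v *)
Require Import Defs.
From mathcomp Require Import all_boot all_order all_algebra.
From mathcomp Require Import all_classical all_reals all_analysis.
From mathcomp Require Import all_fingroup.

Import Order.TTheory GRing.Theory Num.Theory.

Local Open Scope ring_scope.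

(** Write [j] for the urn drawn from at stage [t], [e] and [e'] for the
    probabilities that the first [t] and the first [t.+1] draws are blue, and
    [b] and [b'] for the probabilities of the events (these draws are blue and
    the next marble of urn [i] is red).  The ratio for urn [i] equals
    [(b' / b) * (e / e')], so the factor [e / e'] is common to both sides and
    only [b' / b] has to be compared.

    For [i != j] the event behind [b'] is contained in the one behind [b], since
    the draw from [j] leaves the next marble of [i] unchanged and only adds a
    constraint; hence [b' / b <= 1] ([next_red_all_blue_subset]).

    For [i = j] one has [b' = b] ([prob_next_red_drawn]).  Given the urns that
    have a red marble, all positions of the red marbles are equally likely, so
    the joint law of the positions is invariant under permuting the positions
    inside each urn ([profile_law_invariant]).  The transposition of two
    consecutive positions of [j] exchanges the events (the first [t] draws are
    blue and the next marble of [j] is red) and (the first [t.+1] draws are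
    blue and the next marble of [j] is red), because the first [t] draws being
    blue only says that no red marble sits among the positions already drawn
    ([all_blueP]). *)

Section Search.
Context {R : realType} {V : finType} {d : measure_display}
  {T : measurableType d} {P : probability T R}.
Context (M : search_problem V P).
Local Open Scope classical_set_scope.

(** * The joint law of the positions of the red marbles *)

(** A dependent finite function, rather than a plain one, so that the joint
    positions range over a finite type and their law is a finite sum over
    atoms. *)
Local Notation positions := {dffun forall i : V, option 'I_(marbles M i)}.

Definition profile (w : T) : positions := [ffun i => red_pos M i w].

Lemma measurable_profile (A : set positions) : measurable (profile @^-1` A).
Proof.
rewrite (_ : _ @^-1` _ =
  \bigcup_(o in A) \bigcap_(i in [set: V]) (red_pos M i @^-1` [set o i])).
  apply: fin_bigcup_measurable; first exact: finite_finset.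
  move=> o _; apply: fin_bigcap_measurable; first exact: finite_finset.
  by move=> i _; exact: measurable_red_pos.
apply/seteqP; split=> [w Aw | w [p Ap pw]].
  by exists (profile w) => // i _; rewrite /= ffunE.
suff -> : (profile @^-1` A) w = A p by [].
by congr (A _); apply/ffunP => i; rewrite ffunE; exact: pw.
Qed.

Lemma prob_profile (A : set positions) :
  P (profile @^-1` A) = (\sum_(o \in A) P (profile @^-1` [set o]))%E.
Proof.
rewrite -[in LHS](image_id A) -(bigcup_imset1 A id) preimage_bigcup.
apply: measure_fin_bigcup; first exact: finite_finset.
- apply/trivIsetP => p q _ _ /eqP pq; apply/seteqP; split=> // w [/= wp wq].
  by case: pq; rewrite -wp -wq.
- by move=> o _; exact: measurable_profile.
Qed.

(** Given the set of urns with a red marble, the positions are uniform on a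
    product, so the mass of an atom depends only on that set. *)
Lemma prob_profile1_eq (o o' : positions) :
  (forall i, isSome (o i) = isSome (o' i)) ->
  P (profile @^-1` [set o]) = P (profile @^-1` [set o']).
Proof.
pose S : {set V} := finset (fun i => isSome (o i)).
suff massE (p : positions) : (forall i, isSome (p i) = isSome (o i)) ->
    P (profile @^-1` [set p]) =
    (P (red_urns_are (red_pos M) S) *
     (\prod_(i in S) ((marbles M i)%:R : R)^-1)%:E)%E.
  by move=> oo'; rewrite !massE.
(* An urn outside [S] has no position, but the uniform law is expressed with a
   position for every urn. *)
move=> po; pose k i := odflt (Ordinal (marbles_gt0 M i)) (p i).
rewrite -(red_pos_uniform S k); congr (P _).
apply/seteqP; split=> w /= => [wp|[wS wk]].
  have wpi i : red_pos M i w = p i by rewrite -wp ffunE.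
  split=> [i|i]; rewrite inE -po ?/urn_has_red /= ?wpi /k.
    by case: (p i).
  by case: (p i).
apply/ffunP => i; rewrite ffunE; have := wS i; have := wk i.
rewrite inE -po /urn_has_red /k /=; case: (p i) => [m /(_ isT)|_ []] //=.
by case: (red_pos M i w) => // m _ h; have : false by apply: h.
Qed.

Definition permute_profile (s : forall i, {perm 'I_(marbles M i)})
    (o : positions) : positions :=
  [ffun i => omap (s i) (o i)].

Lemma permute_profileK s :
  cancel (permute_profile s) (permute_profile (fun i => (s i)^-1%g)).
Proof.
move=> o; apply/ffunP => i; rewrite !ffunE.
by case: (o i) => //= m; rewrite permK.
Qed.

Lemma permute_profileVK s :
  cancel (permute_profile (fun i => (s i)^-1%g)) (permute_profile s).
Proof.
move=> o; apply/ffunP => i; rewrite !ffunE.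
by case: (o i) => //= m; rewrite permKV.
Qed.

(** Permuting positions preserves the set of urns with a red marble, hence the
    mass of every atom. *)
Lemma profile_law_invariant s A :
  P (profile @^-1` (permute_profile s @^-1` A)) = P (profile @^-1` A).
Proof.
rewrite prob_profile [RHS]prob_profile.
rewrite [RHS](@reindex_fsbig _ _ _ _ _ (permute_profile s)
  (permute_profile s @^-1` A)).
  apply: eq_fsbigr => o _; apply: prob_profile1_eq => i.
  by rewrite ffunE; case: (o i).
split=> [p // | p q _ _ | p Ap]; first exact: (can_inj (permute_profileK s)).
exists (permute_profile (fun i => (s i)^-1%g) p); last exact: permute_profileVK.
by rewrite /= permute_profileVK.
Qed.

(** * Drawing blue marbles *)

Lemma stateS (u : (total_marbles M).-tuple V) (t : 'I_(total_marbles M)) i :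
  state u t.+1 i = (state u t i + (tnth u t == i))%N.
Proof.
rewrite /state (take_nth (tnth u t)) ?size_tuple// -cats1 count_cat /= addn0.
by rewrite -tnth_nth.
Qed.

Lemma all_blueS (u : (total_marbles M).-tuple V) (t : 'I_(total_marbles M)) :
  all_blue u t.+1 = all_blue u t `\` next_red M (state u t) (tnth u t).
Proof.
apply/seteqP; split=> w /= => [blue|[blue nred] s].
  by split=> [s st|]; apply: blue => //; exact: ltnW.
by rewrite ltnS leq_eqVlt => /predU1P[/val_inj -> //|]; exact: blue.
Qed.

(** The draws from one urn remove its positions in increasing order, so only
    the number of draws from each urn matters and not their interleaving. *)
Lemma all_blueP (u : (total_marbles M).-tuple V) t w :
  (t <= total_marbles M)%N ->
  all_blue u t w <->
  forall i m, red_pos M i w = Some m -> (state u t i <= m)%N.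
Proof.
elim: t => [_|t IH tn]; first by split=> // _ i m _; rewrite /state take0.
have {}IH := IH (ltnW tn).
have stS i := stateS u (Ordinal tn) i.
have blueS := all_blueS u (Ordinal tn); rewrite /= in stS blueS.
rewrite blueS; set j := tnth u _ in stS *.
split=> [[/IH blue nred] i m im|blue].
  rewrite stS; case: (eqVneq j i) m im => [<- | _] m im; last first.
    by rewrite addn0 blue.
  rewrite addn1 ltn_neqAle blue// andbT.
  by apply/eqP => mE; apply: nred; exists m.
split=> [|[m jm mE]].
  by apply/IH => i m /blue; rewrite stS; apply/leq_trans/leq_addr.
by have := blue _ _ jm; rewrite stS eqxx addn1 mE ltnn.
Qed.

(** The event that all draws so far were blue and the next marble of urn [i] is
    red, expressed on the joint positions, where permutations act. *)
Definition blue_then_red (x : V -> nat) (i : V) : set positions :=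
  [set p : positions | (forall k m, p k = Some m -> (x k <= m)%N) /\
    exists2 m, p i = Some m & m = x i :> nat].

(** In urn [i] itself, a red marble at position [x i] already implies that the
    removed marbles were blue; only the constraints on the other urns remain. *)
Lemma blue_then_redP (x : V -> nat) i (a : 'I_(marbles M i)) (p : positions) :
  a = x i :> nat ->
  blue_then_red x i p <->
  p i = Some a /\ forall k m, i != k -> p k = Some m -> (x k <= m)%N.
Proof.
move=> ax; split=> [[blue [m im mE]] | [ia blue]].
  split=> [|k n _]; last exact: blue.
  by rewrite im; congr Some; apply: val_inj; rewrite /= mE ax.
split; last by exists a.
move=> k m; case: (eqVneq i k) m => [<- | ik] m; last exact: blue.
by rewrite ia => -[<-]; rewrite ax.
Qed.

Lemma next_red_all_blueE (u : (total_marbles M).-tuple V) t i :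
  (t <= total_marbles M)%N ->
  next_red M (state u t) i `&` all_blue u t =
  profile @^-1` blue_then_red (state u t) i.
Proof.
move=> tn; apply/seteqP; split=> w /=.
  move=> [[m im mE] /(all_blueP _ _ _ tn) blue]; split=> [k n|].
    by rewrite ffunE; exact: blue.
  by exists m; rewrite ?ffunE.
move=> [blue [m]]; rewrite ffunE => im mE; split; first by exists m.
by apply/(all_blueP _ _ _ tn) => k n kn; apply: blue; rewrite ffunE.
Qed.

Lemma measurable_next_red_all_blue (u : (total_marbles M).-tuple V) t i :
  (t <= total_marbles M)%N ->
  measurable (next_red M (state u t) i `&` all_blue u t).
Proof. by move=> tn; rewrite next_red_all_blueE//; exact: measurable_profile. Qed.

(** * Comparing two consecutive stages *)

Lemma next_red_all_blue_subset (u : (total_marbles M).-tuple V)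
    (t : 'I_(total_marbles M)) i : tnth u t != i ->
  next_red M (state u t.+1) i `&` all_blue u t.+1 `<=`
  next_red M (state u t) i `&` all_blue u t.
Proof.
move=> /negPf ti w; rewrite all_blueS => -[[m im mE] [blue _]]; split=> //.
by exists m; rewrite // mE stateS ti addn0.
Qed.

(** With [x_j] marbles removed from the drawn urn [j], its red marble is as
    likely to be at position [x_j] as at the next one: the transposition of the
    two positions preserves the law, and by [blue_then_redP] it exchanges the
    two events, whose constraints on the other urns are the same. *)
Lemma prob_next_red_drawn (u : (total_marbles M).-tuple V)
    (t : 'I_(total_marbles M)) :
  (state u t.+1 (tnth u t) < marbles M (tnth u t))%N ->
  P (next_red M (state u t.+1) (tnth u t) `&` all_blue u t.+1) =
  P (next_red M (state u t) (tnth u t) `&` all_blue u t).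
Proof.
set j := tnth u t => bN.
have jS : state u t.+1 j = (state u t j).+1 by rewrite stateS eqxx addn1.
have aN : (state u t j < marbles M j)%N by rewrite (ltn_trans _ bN)// jS.
pose a := Ordinal aN; pose b := Ordinal bN.
pose s := dfwith (fun i => 1%g : {perm 'I_(marbles M i)}) j (tperm a b).
have sj : s j = tperm a b by rewrite /s dfwithin.
have sk k : j != k -> s k = 1%g by move=> jk; rewrite /s dfwithout.
rewrite !next_red_all_blueE ?(ltnW (ltn_ord t))//.
rewrite -(profile_law_invariant s); congr (P (_ @^-1` _)).
have sjE (p : positions) : permute_profile s p j = Some b <-> p j = Some a.
  rewrite ffunE sj; case: (p j) => [m|] //=; split=> [[mb]|[->]].
    by congr Some; apply: (@perm_inj _ (tperm a b)); rewrite mb tpermL.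
  by rewrite tpermL.
have skE (p : positions) k : j != k -> permute_profile s p k = p k.
  by move=> jk; rewrite ffunE sk//; case: (p k) => //= m; rewrite perm1.
have xk k : j != k -> state u t.+1 k = state u t k.
  by move=> /negPf jk; rewrite stateS -/j jk addn0.
apply/seteqP; split=> p /=.
  move=> /(@blue_then_redP _ _ b)-/(_ erefl)[/sjE ja blue].
  apply/(@blue_then_redP _ _ a) => //; split=> // k m jk kp.
  by rewrite -xk// blue// skE.
move=> /(@blue_then_redP _ _ a)-/(_ erefl)[ja blue].
apply/(@blue_then_redP _ _ b) => //; split=> [|k m jk]; first exact/sjE.
by rewrite skE// xk//; exact: blue.
Qed.

Lemma prob_next_red_le (u : (total_marbles M).-tuple V)
    (t : 'I_(total_marbles M)) i :
  (state u t.+1 (tnth u t) < marbles M (tnth u t))%N ->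
  (P (next_red M (state u t.+1) i `&` all_blue u t.+1) <=
   P (next_red M (state u t) i `&` all_blue u t))%E.
Proof.
move=> bN; case: (eqVneq (tnth u t) i) => [<-|ti].
  by rewrite prob_next_red_drawn.
apply: le_measure.
- exact/mem_set/measurable_next_red_all_blue/ltn_ord.
- exact/mem_set/measurable_next_red_all_blue/ltnW/ltn_ord.
- exact: next_red_all_blue_subset.
Qed.

End Search.

Theorem theorem8 (R : realType) (V : finType) (d : measure_display)
    (T : measurableType d) (P : probability T R) (M : search_problem V P)
    (u : (total_marbles M).-tuple V) (u_valid : valid_policy u)
    (t : 'I_(total_marbles M)) (i : V) :
  prob_red_defined u t.+1 (tnth u t) ->
  prob_red_defined u t (tnth u t) ->
  prob_red_defined u t.+1 i ->
  prob_red_defined u t i ->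
  0 < prob_red u t (tnth u t) ->
  0 < prob_red u t i ->
  prob_red u t.+1 (tnth u t) / prob_red u t (tnth u t) >=
  prob_red u t.+1 i / prob_red u t i.
Proof.
move=> [bN _] _ _ _; rewrite /prob_red /cond_prob prob_next_red_drawn//.
have : fine (P (next_red M (state u t.+1) i `&` all_blue u t.+1)%classic) <=
       fine (P (next_red M (state u t) i `&` all_blue u t)%classic).
  apply: fine_le; last exact: prob_next_red_le.
    exact/fin_num_measure/measurable_next_red_all_blue/ltn_ord.
  exact/fin_num_measure/measurable_next_red_all_blue/ltnW/ltn_ord.
set b' := fine _; set b := fine _; set a := fine _.
have : 0 <= fine (P (all_blue u t.+1)) by exact: fine_ge0.
have : 0 <= fine (P (all_blue u t)) by exact: fine_ge0.
set e := fine _; set e' := fine _ => e_ge0; rewrite -invr_ge0 => e'_ge0 b'b.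
move=> ae be.
(* Since division by 0 gives 0, the positive conditional probabilities force
   [e], [a] and [b] to be positive. *)
have e_gt0 : 0 < e.
  rewrite lt_def e_ge0 andbT; apply: contraTneq ae => ->.
  by rewrite invr0 mulr0 ltxx.
have a_gt0 : 0 < a by move: ae; rewrite pmulr_lgt0// invr_gt0.
have b_gt0 : 0 < b by move: be; rewrite pmulr_lgt0// invr_gt0.
(* Both sides now become a multiple of [e / e'], with factors [b' / b] and
   [a / a]. *)
rewrite !invf_div ![e / _]mulrC mulrACA [leRHS]mulrACA.
apply: ler_wpM2r; first exact: mulr_ge0.
by rewrite divff ?gt_eqF// ler_pdivrMr// mul1r.
Qed.
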